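(* Let $\mathcal{G}$ be an additive subgroup of $\mathbb{R}$, $n$ a positive integer, and $c,m\in\mathcal{G}$ with $c>0$, $m\geq 0$. For every $k\in\{0,1,\ldots,n-1\}$, $\mathrm{SKC}_k=\mathrm{SKF}_k$ (as sets of functions $[n]\to\mathcal{G}$). Consequently, for all $k,k'\in\{0,\ldots,n-1\}$ the sets $\mathrm{SKC}_k$ and $\mathrm{SKC}_{k'}$ have the same cardinality, and in the case $\mathcal{G}=\mathbb{Z}$, $|\mathrm{SKC}_k|=c(mn+c)^{n-1}$.
   Context: $[n]=\{1,\ldots,n\}$. A chip configuration is a function $D:[n]\to\mathcal{G}$ (chip counts on the non-sink vertices of the complete graph on $\{0,1,\ldots,n\}$, $0$ being the sink, with edges among $[n]$ of capacity $m$ and edges to $0$ of capacity $c$). $D\geq 0$ means $D(i)\geq 0$ for all $i$. For nonempty $S\subseteq[n]$ with $|S|=f$, firing $\phi_S(D)$ decreases $D(i)$ by $m(n-f)+c$ for each $i\in S$ and increases $D(j)$ by $mf$ for each $j\notin S$; $S$ can legally fire in $D$ iff $D(i)\geq m(n-f)+c$ for all $i\in S$. For nonempty $T\subseteq[n]$ with $|T|=p$, borrowing $\beta_T(D)$ increases $D(i)$ by $m(n-p)+c$ for each $i\in T$ and decreases $D(j)$ by $mp$ for each $j\notin T$; $T$ can legally borrow in $D$ iff $D(j)\geq mp$ for all $j\in[n]\setminus T$. For $k\in\{0,\ldots,n-1\}$, $D$ is a $k$-skeletal chip configuration iff: (C0) $D\geq 0$; (C1) no $S\subseteq[n]$ with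 $0<|S|\leq k+1$ can legally fire in $D$; (C2) for every nonempty $T\subseteq[n]$ that can legally borrow in $D$, there exists $S\subseteq[n]$ with $0<|S|\leq k+1$ that can legally fire in $\beta_T(D)$. $\mathrm{SKC}_k$ is the set of $k$-skeletal chip configurations. For $f:[n]\to\mathcal{G}$, let $x_0\leq\cdots\leq x_{n-1}$ be the values $f(1),\ldots,f(n)$ sorted weakly increasingly; $f$ is $k$-skeletal iff (P0) $x_0\geq 0$; (P1) $x_i<mi+c$ for all $i\in\{n-k-1,\ldots,n-1\}$; (P2) for every $i\in\{0,\ldots,n-k-1\}$ there is $j\in\{i,\ldots,i+k\}$ with $x_j\geq mj$. $\mathrm{SKF}_k$ is the set of $k$-skeletal functions $[n]\to\mathcal{G}$. *)

(* Defs.v *)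
From HB Require Import structures.
From mathcomp Require Import all_boot all_order all_algebra finmap.
From mathcomp Require Import boolp classical_sets functions cardinality reals.

Set Implicit Arguments.
Unset Strict Implicit.
Unset Printing Implicit Defensive.

Import Order.TTheory GRing.Theory Num.Theory.

Local Open Scope classical_set_scope.
Local Open Scope ring_scope.

(* The non-sink vertices 1, ..., n are represented by 'I_n. A chip count lives
   in an additive subgroup G of the reals: configurations are real-valued and
   membership of all values in G is imposed in the sets SKC and SKF. *)

Definition fire (R : realType) (n : nat) (c m : R) (S : {set 'I_n})
    (D : 'I_n -> R) : 'I_n -> R :=
  fun i => if i \in S then D i - (m *+ (n - #|S|) + c) else D i + m *+ #|S|.

Definition can_fire (R : realType) (n : nat) (c m : R) (S : {set 'I_n})
    (D : 'I_n -> R) : Prop :=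
  forall i, i \in S -> m *+ (n - #|S|) + c <= D i.

Definition borrow (R : realType) (n : nat) (c m : R) (T : {set 'I_n})
    (D : 'I_n -> R) : 'I_n -> R :=
  fun i => if i \in T then D i + (m *+ (n - #|T|) + c) else D i - m *+ #|T|.

Definition can_borrow (R : realType) (n : nat) (m : R) (T : {set 'I_n})
    (D : 'I_n -> R) : Prop :=
  forall j, j \notin T -> m *+ #|T| <= D j.

Definition skeletal_config (R : realType) (n : nat) (c m : R) (k : nat)
    (D : 'I_n -> R) : Prop :=
  [/\ forall i, 0 <= D i,
      forall S : {set 'I_n}, (0 < #|S| <= k.+1)%N -> ~ can_fire c m S D
    & forall T : {set 'I_n}, T != finset.set0 -> can_borrow m T D ->
        exists2 S : {set 'I_n},
          (0 < #|S| <= k.+1)%N & can_fire c m S (borrow c m T D)].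

Definition SKC (R : realType) (G : zmodClosed R) (n : nat) (c m : R) (k : nat)
    : set ('I_n -> R) :=
  [set D | (forall i, D i \in G) /\ skeletal_config c m k D].
Arguments SKC {R} G n c m k.

(* order_stat f i is x_i, where x_0 <= ... <= x_(n-1) are the values of f
   counted with multiplicity; the default 0 is only reached for n <= i. *)
Definition order_stat (R : realType) (n : nat) (f : 'I_n -> R) (i : nat) : R :=
  nth 0 (sort <=%R [seq f j | j : 'I_n]) i.

Definition skeletal_fun (R : realType) (n : nat) (c m : R) (k : nat)
    (f : 'I_n -> R) : Prop :=
  [/\ 0 <= order_stat f 0,
      forall i : nat, (n - k - 1 <= i <= n - 1)%N ->
        order_stat f i < m *+ i + c
    & forall i : nat, (i <= n - k - 1)%N ->
        exists2 j : nat, (i <= j <= i + k)%N & m *+ j <= order_stat f j].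

Definition SKF (R : realType) (G : zmodClosed R) (n : nat) (c m : R) (k : nat)
    : set ('I_n -> R) :=
  [set f | (forall i, f i \in G) /\ skeletal_fun c m k f].
Arguments SKF {R} G n c m k.

(* Main.v *)
(* A set S of given size can fire, or T can borrow, iff suitable order statistics
   are large, and v <= x_i iff at most i values lie below v; counting values
   below thresholds then turns (C0)-(C2) into (P0)-(P2).

   For the cardinalities put N = m n + c. Firing and borrowing generate the
   lattice moves f |-> f - N a + m |a|, a : [n] -> Z, |a| the sum of a. Let
   y_0 <= y_1 <= ... be the sorted enumeration, over all integer indices, of the
   periodic multiset {f i + N z}, and z_t = y_t - m t, so that z_(t+n) = z_t + c.
   The moves only shift the index of z, and f is k-skeletal iff its values are
   y_0, ..., y_(n-1) (a window in [0, N)) and index 0 is the end of the last run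
   of k+1 consecutive negative z_t. Such an end exists and is unique, so the
   k-skeletal functions form a transversal of the lattice orbits for every k.
   Another transversal is 0 <= f 0 < c, 0 <= f i - f 0 < N, which is visibly of
   size c N^(n-1) over the integers. *)

Require Import Defs.
From HB Require Import structures.
From mathcomp Require Import all_boot all_order all_algebra finmap.
From mathcomp Require Import boolp classical_sets functions cardinality reals.
From mathcomp Require Import zify ring lra.

Import Order.TTheory GRing.Theory Num.Theory.

Local Open Scope classical_set_scope.
Local Open Scope ring_scope.

(** * Order statistics as counts below thresholds *)

Definition below {R : realType} {n : nat} (D : 'I_n -> R) (v : R) : {set 'I_n} :=
  [set j | D j < v]%SET.

Lemma le_order_stat (R : realType) (n : nat) (D : 'I_n -> R) (i : nat) (v : R) :
  (i < n)%N -> (v <= order_stat D i) = (#|below D v| <= i)%N.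
Proof.
move=> lt_in; rewrite /order_stat.
set s := sort _ _.
have s_sorted : sorted <=%O s by apply/sort_sorted/le_total.
have size_s : size s = n by rewrite size_sort size_map size_enum_ord.
have -> : #|below D v| = count (< v)%O s.
  rewrite (permP (permEl (perm_sort _ _))) count_map -size_filter cardE {1}/enum_mem.
  by rewrite -enumT; apply/congr1/eq_filter => j; rewrite /= inE. 
apply/idP/idP => [|le_ci]; last by rewrite nth_count_ge // le_ci size_s.
by apply: contraTT; rewrite -ltnNge -ltNge; apply: nth_count_lt.
Qed.

Lemma card_subset_ge (T : finType) (A : {set T}) (k : nat) : (k <= #|A|)%N ->
  exists2 S : {set T}, S \subset A & #|S| = k.
Proof.
move=> le_kA; exists [set x in take k (enum A)]%SET.
  by apply/fintype.subsetP => x; rewrite inE => /mem_take; rewrite mem_enum.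
by rewrite cardsE (card_uniqP _) ?take_uniq ?enum_uniq // size_takel // -cardE.
Qed.

Lemma card_superset_le (T : finType) (A : {set T}) (k : nat) :
  (#|A| <= k <= #|T|)%N -> exists2 S : {set T}, A \subset S & #|S| = k.
Proof.
move=> /andP[le_Ak le_kT].
have [|S sSA cardS] := @card_subset_ge _ (~: A) (#|T| - k).
  by rewrite cardsCs finset.setCK leq_sub2l.
exists (~: S); first by rewrite -finset.setCS finset.setCK.
by rewrite cardsCs finset.setCK cardS subKn.
Qed.

Lemma skeletal_funE (R : realType) (n : nat) (c m : R) (k : nat) (D : 'I_n -> R) :
    (k < n)%N -> skeletal_fun c m k D <->
  [/\ forall i, 0 <= D i,
      forall i, (n - k - 1 <= i < n)%N -> (i < #|below D (m *+ i + c)|)%N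
    & forall i, (i <= n - k - 1)%N ->
        exists2 j, (i <= j <= i + k)%N & (#|below D (m *+ j)| <= j)%N].
Proof.
move=> lt_kn; have n_gt0 : (0 < n)%N by apply: leq_ltn_trans lt_kn.
have P0 : 0 <= order_stat D 0 <-> forall i, 0 <= D i.
  rewrite le_order_stat // leqn0 finset.cards_eq0; split=> [/eqP D0 i | D_ge0].
    by rewrite leNgt; have := finset.in_set0 i; rewrite -D0 inE => ->.
  by apply/eqP/finset.setP => i; rewrite !inE ltNge D_ge0.
rewrite /skeletal_fun; split=> -[/P0 D_ge0 P1 P2]; split=> // i Hi.
- by rewrite ltnNge -le_order_stat -?ltNge ?P1 //; lia.
- by have [j Hj Hmj] := P2 _ Hi; exists j => //; rewrite -le_order_stat //; lia.
- by rewrite ltNge le_order_stat -?ltnNge ?P1 //; lia.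
- by have [j Hj Hmj] := P2 _ Hi; exists j => //; rewrite le_order_stat //; lia.
Qed.

(** * Firing and borrowing conditions as counts *)

(** A set of [n - i] vertices can fire iff each holds at least [m i + c], so one exists iff at most
    [i] values lie below that. *)
Lemma no_fire_below (R : realType) (n : nat) (c m : R) (k : nat) (D : 'I_n -> R) :
    (k < n)%N ->
  (forall S : {set 'I_n}, (0 < #|S| <= k.+1)%N -> ~ can_fire c m S D) <->
  (forall i, (n - k - 1 <= i < n)%N -> (i < #|below D (m *+ i + c)|)%N).
Proof.
move=> lt_kn; split=> [noS i Hi | lt_below S HS fS].
  rewrite ltnNge; apply/negP => le_bi.
  have [|S sSD cardS] := @card_subset_ge _ (~: below D (m *+ i + c)) (n - i).
    by rewrite cardsCs finset.setCK card_ord leq_sub2l.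
  apply: (noS S); first by rewrite cardS; lia.
  move=> j /(fintype.subsetP sSD); rewrite !inE -leNgt; apply: le_trans.
  by rewrite cardS subKn //; lia.
have cardS : (#|S| <= n)%N by rewrite -[leqRHS]card_ord max_card.
have /lt_below : (n - k - 1 <= n - #|S| < n)%N by lia.
rewrite ltnNge => /negP; apply.
suff /subset_leq_card : below D (m *+ (n - #|S|) + c) \subset ~: S.
  by rewrite [X in (_ <= X)%N]cardsCs finset.setCK card_ord.
apply/fintype.subsetP => j; rewrite !inE => lt_Dj; apply/negP => /fS.
by rewrite leNgt lt_Dj.
Qed.

(** Take [S] in [T] of size [#|T| - j] among the values at least [m j]: borrowing lifts them to at
    least [m j + m (n - #|T|) + c], which is the firing threshold of [S]. *)
Lemma fire_after_borrow (R : realType) (n : nat) (c m : R) (k : nat)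
    (D : 'I_n -> R) (T : {set 'I_n}) (j : nat) :
    (j < #|T| <= j + k.+1)%N -> (#|below D (m *+ j)| <= j)%N ->
  exists2 S : {set 'I_n}, (0 < #|S| <= k.+1)%N & can_fire c m S (borrow c m T D).
Proof.
move=> HjT le_bj.
have [|S sST cardS] := @card_subset_ge _ (T :\: below D (m *+ j)) (#|T| - j).
  rewrite cardsD leq_sub2l // (leq_trans _ le_bj) //.
  exact: subset_leq_card (finset.subsetIr _ _).
exists S; first by rewrite cardS; lia.
have cardT : (#|T| <= n)%N by rewrite -[leqRHS]card_ord max_card.
move=> i /(fintype.subsetP sST); rewrite !inE -leNgt => /andP[le_mj iT].
rewrite /borrow iT cardS addrA lerD2r.
have -> : (n - (#|T| - j) = j + (n - #|T|))%N by lia.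
by rewrite mulrnDr lerD2r.
Qed.

Lemma skeletal_configE (R : realType) (n : nat) (c m : R) (k : nat)
    (D : 'I_n -> R) (hm : 0 <= m) (lt_kn : (k < n)%N) :
  skeletal_config c m k D <-> skeletal_fun c m k D.
Proof.
rewrite skeletal_funE //.
split=> -[D_ge0 /no_fire_below HP1 HP2]; split=> //; first exact: HP1.
- have lt_below := HP1 lt_kn => i Hi.
  apply: contrapT => no_j.
  have lt_jb j : (i <= j <= i + k)%N -> (j < #|below D (m *+ j)|)%N.
    by move=> Hj; rewrite ltnNge; apply/negP => le_bj; apply: no_j; exists j.
  have below0 : #|below D (m *+ 0)| = 0%N.
    apply/eqP; rewrite finset.cards_eq0; apply/eqP/finset.setP => l.
    by rewrite !inE ltNge D_ge0.
  have i_gt0 : (0 < i)%N.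
    by case: (posnP i) => // i0; have := lt_jb 0%N; rewrite below0 i0; lia.
  (* The bad window is extended up to the first [p] past it with at most [p] values below [m p];
     then [p] vertices including all of these can borrow. *)
  have exp : exists p, (i + k < p)%N && (#|below D (m *+ p)| <= p)%N.
    exists n; apply/andP; split; first by lia.
    by rewrite -[leqRHS]card_ord max_card.
  case: (ex_minnP exp) => p /andP[lt_ikp le_bp] p_min.
  have lt_jb' j : (i <= j < p)%N -> (j < #|below D (m *+ j)|)%N.
    move=> /andP[le_ij lt_jp]; case: (leqP j (i + k)) => [le_j | lt_j].
      by apply: lt_jb; rewrite le_ij.
    by rewrite ltnNge; apply/negP => le_bj; have := p_min j; rewrite lt_j le_bj; lia.
  have le_pn : (p <= n)%N.
    apply: p_min; apply/andP; split; first by lia.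
    by rewrite -[leqRHS]card_ord max_card.
  have [|T sbT cardT] := @card_superset_le _ (below D (m *+ p)) p.
    by rewrite le_bp card_ord.
  have [||S HS fS] := HP2 T.
  + by rewrite -card_gt0 cardT; lia.
  + move=> j; apply: contraNT; rewrite -ltNge => lt_D.
    by apply: (fintype.subsetP sbT); rewrite inE -cardT.
  (* A firing vertex outside T would already violate the bound on the largest
     value, so S lies inside T. *)
  have sST : S \subset T.
    apply/fintype.subsetP => l lS; apply/negPn/negP => lT.
    have := fS l lS; rewrite /borrow (negPf lT) cardT => le_D.
    have /lt_below : (n - k - 1 <= n - 1 < n)%N by lia.
    rewrite ltnNge => /negP; apply.
    suff /subset_leq_card : below D (m *+ (n - 1) + c) \subset [set~ l]%SET.
      by rewrite cardsC1 card_ord subn1.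
    apply/fintype.subsetP => q; rewrite !inE; apply: contraTneq => ->; rewrite -leNgt.
    have : m *+ (n - 1) <= m *+ (n - #|S| + p) by rewrite ler_wpMn2l //; lia.
    by rewrite mulrnDr; lra.
  have le_Sp : (#|S| <= p)%N by rewrite -cardT subset_leq_card.
  (* As [#|S| <= k.+1], the index [p - #|S|] is still in the extended bad window, yet the values
     below [m (p - #|S|)] all sit in [T :\: S]. *)
  have /lt_jb' : (i <= p - #|S| < p)%N by lia.
  rewrite ltnNge => /negP; apply.
  suff /subset_leq_card : below D (m *+ (p - #|S|)) \subset T :\: S.
    by rewrite cardsD (finset.setIidPr sST) cardT.
  apply/fintype.subsetP => l; rewrite !inE => lt_D; apply/andP; split; last first.
    apply: (fintype.subsetP sbT); rewrite inE (lt_le_trans lt_D) // ler_wpMn2l //; lia.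
  apply/negP => lS; have := fS l lS; rewrite /borrow (fintype.subsetP sST) // cardT.
  have -> : (n - #|S| = p - #|S| + (n - p))%N by lia.
  by rewrite mulrnDr; move: lt_D; lra.
- exact: HP1.
- move=> T T0 _; have T_gt0 : (0 < #|T|)%N by rewrite card_gt0.
  have cardT : (#|T| <= n)%N by rewrite -[leqRHS]card_ord max_card.
  (* A small [T] fires back as a whole ([j = 0]), no value being negative; for a large one, (P2) on
     the [k.+1] indices before [#|T|] supplies [j]. *)
  case: (leqP #|T| k.+1) => [le_Tk | lt_kT].
    apply: (@fire_after_borrow _ _ _ _ _ _ _ 0%N); first by lia.
    rewrite leqn0 finset.cards_eq0; apply/eqP/finset.setP => l; by rewrite !inE ltNge D_ge0.
  have [|j Hj le_bj] := HP2 (#|T| - k.+1)%N; first by lia.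
  by apply: (@fire_after_borrow _ _ _ _ _ _ _ j) => //; lia.
Qed.

(** * Lattice moves *)

(** For [a] the indicator of [S] this is firing [S], as [N - m #|S| = m (n - #|S|) + c]; the
    opposite [a] is borrowing. *)
Definition shift {R : realType} {n : nat} (c m : R) (a : 'I_n -> int)
    (f : 'I_n -> R) : 'I_n -> R :=
  fun i => f i - (m *+ n + c) *~ a i + m *~ (\sum_j a j).

Lemma shift_comp (R : realType) (n : nat) (c m : R) (a b : 'I_n -> int)
    (f : 'I_n -> R) :
  shift c m b (shift c m a f) = shift c m (fun i => a i + b i) f.
Proof. by apply/funext => i; rewrite /shift big_split /= !mulrzDr; lra. Qed.

Lemma shift0 (R : realType) (n : nat) (c m : R) (a : 'I_n -> int)
    (f : 'I_n -> R) : (forall i, a i = 0) -> shift c m a f = f.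
Proof.
move=> a0; apply/funext => i; rewrite /shift a0 big1 // !mulr0z; lra.
Qed.

Definition chip_equiv {R : realType} {n : nat} (c m : R) (f g : 'I_n -> R) : Prop :=
  exists a, g = shift c m a f.

Lemma chip_equiv_sym (R : realType) (n : nat) (c m : R) (f g : 'I_n -> R) :
  chip_equiv c m f g -> chip_equiv c m g f.
Proof.
move=> [a ->]; exists (fun i => - a i); rewrite shift_comp shift0 // => i.
exact: subrr.
Qed.

Lemma chip_equiv_trans (R : realType) (n : nat) (c m : R) (f g h : 'I_n -> R) :
  chip_equiv c m f g -> chip_equiv c m g h -> chip_equiv c m f h.
Proof. by move=> [a ->] [b ->]; rewrite shift_comp; eexists. Qed.

Lemma shift_in (R : realType) (G : zmodClosed R) (n : nat) (c m : R)
    (hcG : c \in G) (hmG : m \in G) (a : 'I_n -> int) (f : 'I_n -> R) :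
  (forall i, f i \in G) -> forall i, shift c m a f i \in G.
Proof.
move=> fG i; rewrite /shift rpredD ?rpredB ?rpredMz //.
by rewrite rpredD ?rpredMn.
Qed.

(** * Ceilings, levels and deficient indices *)

Lemma small_mulrz_eq0 (R : realType) (N : R) (a : int) :
  - N < N *~ a < N -> a = 0.
Proof.
rewrite -mulrzr => HN; have N_gt0 : 0 < N by lra.
case: (ltgtP a 0) => // [a_lt0 | a_gt0]; exfalso.
  have : a%:~R <= (-1)%:~R :> R by rewrite ler_int; lia.
  by rewrite mulrN1z; nra.
have : 1%:~R <= a%:~R :> R by rewrite ler_int; lia.
by rewrite mulr1z; nra.
Qed.

(** The quotient lies in []-1, 1]], so its ceiling is 1 or 0 according to its being positive or
    not. *)
Lemma ceil_box (R : realType) (N x v : R) : 0 <= x < N -> 0 <= v <= N ->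
  Num.ceil ((v - x) / N) = (x < v)%R%:Z.
Proof.
move=> /andP[x_ge0 lt_xN] /andP[v_ge0 le_vN].
have N_gt0 : 0 < N by lra.
case: ltP => lt_xv; apply: ceil_def; rewrite ltr_pdivlMr // ler_pdivrMr //.
  by rewrite subrr mul0r mul1r; apply/andP; split; lra.
by rewrite sub0r mulrN1z mulN1r mul0r; apply/andP; split; lra.
Qed.

(* The number of y_s < m t with s >= 0, minus the number of y_s >= m t with
   s < 0, where y is indexed so that y_0 is its first nonnegative term. *)
Definition level {R : realType} {n : nat} (c m : R) (f : 'I_n -> R) (t : int) : int :=
  \sum_i Num.ceil ((m *~ t - f i) / (m *+ n + c)).

(* y_t < m t, that is, z_t < 0. *)
Definition deficient {R : realType} {n : nat} (c m : R) (f : 'I_n -> R) (t : int) : bool :=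
  t < level c m f t.

Lemma period_gt0 (R : realType) (n : nat) (c m : R) (hc : 0 < c) (hm : 0 <= m) :
  0 < m *+ n + c.
Proof. by rewrite ltr_wpDl // mulrn_wge0. Qed.

Section Level.
Context (R : realType) (n : nat) (c m : R) (hc : 0 < c) (hm : 0 <= m).
Implicit Types (f : 'I_n -> R) (t : int).
Local Notation N := (m *+ n + c).
Let N_gt0 : 0 < N := period_gt0 R n c m hc hm.

(** Subtracting [N a i] from a value adds the integer [a i] to its ceiling; the common summand
    [m |a|] is absorbed by the index. *)
Lemma level_shift a f t :
  level c m (shift c m a f) t = level c m f (t - \sum_i a i) + \sum_i a i.
Proof.
rewrite /level -big_split /=; apply: eq_bigr => i _.
rewrite -[X in _ = _ + X](@intrKceil R) -ceilDrz; last exact: intr_int.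
by rewrite /shift mulrzBr -[N *~ a i]mulrzr; congr Num.ceil; field; rewrite mulr_natr gt_eqF.
Qed.

Lemma deficient_shift a f t :
  deficient c m (shift c m a f) t = deficient c m f (t - \sum_i a i).
Proof. by rewrite /deficient level_shift; lia. Qed.

Lemma level_le f : {homo level c m f : t t' / t <= t'}.
Proof.
move=> t t' le_tt'; apply: ler_sum => i _; apply: le_ceil.
apply: ler_wpM2r; first by rewrite invr_ge0 ltW.
by rewrite lerD2r -(mulrzr _ t) -(mulrzr _ t') ler_wpM2l ?ler_int.
Qed.

(** As [m n <= N], advancing the index by [n] raises each of the [n] ceilings by at most 1. *)
Lemma deficient_subn f t : deficient c m f (t + n%:Z) -> deficient c m f t.
Proof.
rewrite /deficient => lt_t; rewrite -(ltrD2r n%:Z); apply: lt_le_trans lt_t _.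
have -> : n%:Z = \sum_(i < n) 1 by rewrite sumr_const card_ord natz.
rewrite {2}/level -big_split; apply: ler_sum => i _ /=.
rewrite -[X in _ <= _ + X](@ceil1 R) -ceilDrz ?rpred1 //; apply: le_ceil.
rewrite -[X in _ <= _ + X](@divff _ N) ?gt_eqF // -mulrDl.
apply: ler_wpM2r; first by rewrite invr_ge0 ltW.
rewrite sumr_const card_ord natz mulrzDr -pmulrn -addrA (addrC (m *+ n)) addrA.
by rewrite lerD2l lerDl ltW.
Qed.

(** Moving the threshold by [e] periods into [[0, N]] changes each ceiling by [e]; [ceil_box] makes
    the rest an indicator. *)
Lemma level_box f t (v : R) (e : int) : (forall i, 0 <= f i < N) -> 0 <= v <= N ->
  m *~ t + N *~ e = v -> level c m f t = #|below f v|%:Z - e *+ n.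
Proof.
move=> f_box v_box tv.
transitivity (\sum_i ((f i < v)%R%:Z - e)).
  apply: eq_bigr => i _.
  rewrite -(ceil_box _ N) // -[X in _ = _ - X](@intrKceil R) -ceilN ?intr_int //.
  rewrite -ceilDrz ?rpredN ?intr_int // -tv -[N *~ e]mulrzr; congr Num.ceil.
  by field; rewrite mulr_natr gt_eqF.
rewrite sumrB sumr_const card_ord -(big_morph Posz PoszD (erefl _)).
congr (Posz _ - _); rewrite -sum1_card [RHS]big_mkcond /=.
by apply: eq_bigr => i _; rewrite inE; case: ltP.
Qed.

(** Dropping the ceilings bounds the level below by [(m n t - sum f) / N], and [N - m n = c]. *)
Lemma deficient_low f t : t%:~R * c < - \sum_i f i -> deficient c m f t.
Proof.
move=> lt_t; rewrite /deficient -(ltr_int R) /level raddf_sum /=.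
apply: (@lt_le_trans _ _ (\sum_i ((m *~ t - f i) / N))); last first.
  by apply: ler_sum => i _; apply: ceil_ge.
rewrite -mulr_suml ltr_pdivlMr // sumrB sumr_const card_ord.
by move: lt_t; lra.
Qed.

Lemma deficient_high f t : N *+ n - \sum_i f i <= t%:~R * c -> ~~ deficient c m f t.
Proof.
move=> le_t; rewrite /deficient -leNgt -(ler_int R) /level raddf_sum /=.
apply: (@le_trans _ _ (\sum_i ((m *~ t - f i) / N + 1))).
  apply: ler_sum => i _; have := ceilB1_lt ((m *~ t - f i) / N).
  by rewrite mulrzBr; lra.
rewrite big_split /= -mulr_suml -lerBrDr ler_pdivrMr // sumrB !sumr_const card_ord.
by move: le_t; lra.
Qed.

End Level.

(** * Skeletal functions as orbit representatives *)

Section Skeletal.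
Context (R : realType) (n : nat) (c m : R) (hc : 0 < c) (hm : 0 <= m).
Context (k : nat) (lt_kn : (k < n)%N).
Implicit Types (f : 'I_n -> R) (t : int).
Local Notation N := (m *+ n + c).
Let N_gt0 : 0 < N := period_gt0 R n c m hc hm.

Lemma level_low f (i : nat) : (forall j, 0 <= f j < N) -> (i <= n)%N ->
  level c m f i%:Z = #|below f (m *+ i)|%:Z.
Proof.
move=> f_box le_in.
rewrite (level_box _ _ _ _ hc hm f i%:Z (m *+ i) 0) ?mul0rn ?subr0 //; last first.
  by rewrite mulr0z addr0 -pmulrn.
rewrite mulrn_wge0 //=; apply: (@le_trans _ _ (m *+ n)); first by rewrite ler_wpMn2l.
by rewrite lerDl ltW.
Qed.

Lemma level_high f (i : nat) : (forall j, 0 <= f j < N) -> (i <= n)%N ->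
  level c m f (i%:Z - n%:Z) = #|below f (m *+ i + c)|%:Z - n%:Z.
Proof.
move=> f_box le_in.
rewrite (level_box _ _ _ _ hc hm f (i%:Z - n%:Z) (m *+ i + c) 1) //.
- by rewrite natz.
- by rewrite lerD2r ler_wpMn2l // addr_ge0 ?mulrn_wge0 // ltW.
- by rewrite mulr1z mulrzBr -!pmulrn; lra.
Qed.

(** By [m (i - n) + N = m i + c], (P1) at [n - j] is deficiency at [-j]; (P2) keeps its index. *)
Lemma skeletal_fun_deficient f : skeletal_fun c m k f <->
  [/\ forall i, 0 <= f i < N,
      forall j : nat, (0 < j <= k.+1)%N -> deficient c m f (- j%:Z)
    & forall i : nat, (i <= n - k - 1)%N ->
        exists2 j : nat, (i <= j <= i + k)%N & ~~ deficient c m f j%:Z].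
Proof.
have high f' (j : nat) : (forall i, 0 <= f' i < N) -> (0 < j <= k.+1)%N ->
    deficient c m f' (- j%:Z) = (n - j < #|below f' (m *+ (n - j) + c)|)%N.
  move=> f_box Hj; have -> : - j%:Z = (n - j)%N%:Z - n%:Z by lia.
  by rewrite /deficient level_high //; lia.
have low f' (j : nat) : (forall i, 0 <= f' i < N) -> (j <= n)%N ->
    ~~ deficient c m f' j%:Z = (#|below f' (m *+ j)| <= j)%N.
  by move=> f_box Hj; rewrite /deficient level_low //; lia.
rewrite skeletal_funE //; split=> -[P0 P1 P2].
  (* (P1) at the top index bounds all values by [m (n - 1) + c <= N]. *)
  have f_box i : 0 <= f i < N.
    rewrite P0 /=; have /P1 lt_n : (n - k - 1 <= n - 1 < n)%N by lia.
    have : i \in below f (m *+ (n - 1) + c).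
      apply: contraTT lt_n => i_notin; rewrite -leqNgt.
      suff /subset_leq_card : below f (m *+ (n - 1) + c) \subset [set~ i]%SET.
        by rewrite cardsC1 card_ord subn1.
      apply/fintype.subsetP => l; rewrite !inE; apply: contraTneq => ->.
      by rewrite inE in i_notin.
    rewrite inE => /lt_le_trans; apply.
    by rewrite lerD2r ler_wpMn2l // leq_subr.
  split=> // [j Hj | i Hi].
    by rewrite high // P1 //; lia.
  by have [j Hj le_bj] := P2 _ Hi; exists j => //; rewrite low //; lia.
split=> [i | i Hi | i Hi]; first by case/andP: (P0 i).
  have -> : i = (n - (n - i))%N by lia.
  by rewrite -high ?P1 //; lia.
by have [j Hj] := P2 _ Hi; exists j => //; rewrite -low //; lia.
Qed.

(** The [k.+1] indices before [s] include 0 if [s <= k.+1], fall under (P2) if [k.+1 < s <= n], and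
    otherwise are moved back by [n]. *)
Lemma skeletal_no_late_run f (s : nat) : skeletal_fun c m k f -> (0 < s)%N ->
  exists2 j : nat, (0 < j <= k.+1)%N & ~~ deficient c m f (s%:Z - j%:Z).
Proof.
move=> /skeletal_fun_deficient[f_box _ P2].
elim/ltn_ind: s => s IH s_gt0.
case: (leqP s k.+1) => [le_sk | lt_ks].
  exists s; first by lia.
  suff /negPf -> : ~~ deficient c m f (s%:Z - s%:Z) by [].
  rewrite subrr /deficient -[X in level _ _ _ X]/(0%N%:Z) level_low //.
  have -> : #|below f (m *+ 0)| = 0%N; last by lia.
  apply/eqP; rewrite finset.cards_eq0; apply/eqP/finset.setP => l.
  by rewrite !inE ltNge; case/andP: (f_box l) => ->.
case: (leqP s n) => [le_sn | lt_ns].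
  have [|j Hj nd] := P2 (s - k.+1)%N; first by lia.
  exists (s - j)%N; first by lia.
  by have -> : s%:Z - (s - j)%N%:Z = j%:Z by lia.
have [||j Hj nd] := IH (s - n)%N; [by lia | by lia |].
exists j => //; apply: contra nd => nd.
apply: (deficient_subn R n c m hc hm).
by have -> : (s - n)%N%:Z - j%:Z + n%:Z = s%:Z - j%:Z by lia.
Qed.

(** The run of [f] just before 0 becomes a run just before [|a|], too late for a skeletal function
    if [|a| > 0]. *)
Lemma skeletal_shift_sum_le0 a f : skeletal_fun c m k f ->
  skeletal_fun c m k (shift c m a f) -> \sum_i a i <= 0.
Proof.
move=> /skeletal_fun_deficient[_ P1 _] skg; rewrite leNgt; apply/negP => a_gt0.
have [s s_eq] : exists s : nat, \sum_i a i = s%:Z by exists (absz (\sum_i a i)); lia.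
have [|j Hj /negP[]] := skeletal_no_late_run _ s skg; first by lia.
rewrite deficient_shift // s_eq; have -> : s%:Z - j%:Z - s%:Z = - j%:Z by lia.
exact: P1.
Qed.

Lemma skeletal_unique f g : chip_equiv c m f g ->
  skeletal_fun c m k f -> skeletal_fun c m k g -> f = g.
Proof.
move=> [a ->] skf skg; apply/esym/shift0.
have [b f_eq] : chip_equiv c m (shift c m a f) f.
  by apply: chip_equiv_sym; exists a.
have a_le0 := skeletal_shift_sum_le0 a f skf skg.
have a_ge0 : 0 <= \sum_i a i.
  have := skeletal_shift_sum_le0 (fun i => - a i) _ skg.
  rewrite shift_comp shift0 => [/(_ skf)|i]; last exact: subrr.
  by rewrite sumrN oppr_le0.
have a0 : \sum_i a i = 0 by apply/le_anti/andP.
(* With [|a| = 0], each value moves by a multiple of [N] inside [[0, N)]. *)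
move=> i; apply: (small_mulrz_eq0 R N).
case/skeletal_fun_deficient: skf => /(_ i) f_box _ _.
case/skeletal_fun_deficient: skg => /(_ i) g_box _ _.
move: g_box; rewrite /shift a0 mulr0z; lra.
Qed.

Lemma last_run f : exists s : int,
  (forall j : nat, (0 < j <= k.+1)%N -> deficient c m f (s - j%:Z)) /\
  forall s', s < s' ->
    exists2 j : nat, (0 < j <= k.+1)%N & ~~ deficient c m f (s' - j%:Z).
Proof.
(* The [- 1] meets the strict inequality of [deficient_low]. *)
pose t0 := Num.floor ((- \sum_i f i) / c) - 1.
pose t1 := Num.ceil ((N *+ n - \sum_i f i) / c).
have low t : t <= t0 -> deficient c m f t.
  move=> le_t; apply: deficient_low => //; rewrite -ltr_pdivlMr //.
  apply: lt_le_trans (floor_le _); by rewrite ltr_int; move: le_t; rewrite -ltzD1 subrK.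
have high t : t1 <= t -> ~~ deficient c m f t.
  move=> le_t; apply: deficient_high => //; rewrite -ler_pdivrMr //.
  by apply: le_trans (ceil_ge _) _; rewrite ler_int.
(* [P p] says that a run ends just before [t0 + p]; the largest such [p] is sought. *)
pose P (p : nat) := [forall l : 'I_k.+1, deficient c m f (t0 + p%:Z - l.+1%:Z)].
have P0 : exists p, P p.
  by exists 0%N; apply/forallP => l; apply: low; lia.
have P_bounded p : P p -> (p <= absz (t1 - t0)%R + 1)%N.
  move=> /forallP/(_ ord0) d; rewrite leqNgt; apply/negP => lt_p.
  suff /negP : ~~ deficient c m f (t0 + p%:Z - 1) by apply.
  by apply: high; lia.
case: (ex_maxnP P0 P_bounded) => p /forallP Pp p_max.
exists (t0 + p%:Z); split=> [j Hj | s' lt_s'].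
  have lt_jk : (j.-1 < k.+1)%N by lia.
  by have := Pp (Ordinal lt_jk); rewrite /= prednK //; lia.
have : ~~ P (absz (s' - t0)).
  by apply/negP => /p_max; lia.
rewrite negb_forall => /existsP[l nd]; exists l.+1; first exact: (ltn_ord l).
by move: nd; have -> : t0 + (absz (s' - t0)) = s' by lia.
Qed.

Lemma skeletal_exists f : exists2 g, chip_equiv c m f g & skeletal_fun c m k g.
Proof.
have [s [run no_run]] := last_run f.
(* Otherwise a run would also end just before [s + 1]. *)
have ds : ~~ deficient c m f s.
  have [|j Hj] := no_run (s + 1); first by lia.
  case: (ltngtP j 1) => [||->]; [by lia| |by rewrite addrK].
  move=> j_gt1; have -> : s + 1 - j%:Z = s - j.-1%:Z by lia.
  by rewrite run //; lia.
have level_s : level c m f s = s.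
  apply/le_anti/andP; split; first by move: ds; rewrite /deficient -leNgt.
  have : deficient c m f (s - 1) by apply: (run 1%N).
  have : level c m f (s - 1) <= level c m f s by apply: level_le => //; lia.
  by rewrite /deficient; lia.
(* Whole periods bring each value into [[m s, m s + N)]; since the level at [s] is [s], [|a| = - s]
   and the common term subtracts [m s]. *)
pose a i := - Num.ceil ((m *~ s - f i) / N).
have a_sum : \sum_i a i = - s by rewrite sumrN -[RHS]/(- s) -{2}level_s.
exists (shift c m a f); first by exists a.
apply/skeletal_fun_deficient; split.
- move=> i; rewrite /shift a_sum /a.
  have /andP[] := ceil_itv ((m *~ s - f i) / N).
  rewrite mulrzBr ltr_pdivlMr // ler_pdivrMr //.
  move: (Num.ceil _) => e H1 H2; rewrite -[N *~ _]mulrzr !mulrNz.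
  by apply/andP; split; lra.
- move=> j Hj; rewrite deficient_shift // a_sum.
  have -> : - j%:Z - - s = s - j%:Z by lia.
  exact: run.
- move=> i Hi; have [|j Hj nd] := no_run (s + (i + k.+1)%N%:Z); first by lia.
  exists (i + k.+1 - j)%N; first by lia.
  rewrite deficient_shift // a_sum.
  by have -> : (i + k.+1 - j)%N%:Z - - s = s + (i + k.+1)%N%:Z - j%:Z by lia.
Qed.

End Skeletal.

(** * Transversals and their cardinalities *)

Lemma set_bij_card_eq (T U : Type) (A : set T) (B : set U) (f : T -> U) :
  set_bij A B f -> (A #= B)%card.
Proof. by move=> /Pbij[F _]; apply: pcard_eq F. Qed.

Definition transversal {T : Type} (E : T -> T -> Prop) (X A : set T) : Prop :=
  [/\ A `<=` X, forall x, X x -> exists2 a, A a & E x a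
    & forall a b, A a -> A b -> E a b -> a = b].

Lemma transversal_card_eq (T : Type) (E : T -> T -> Prop) (X A B : set T) :
    (forall x y, E x y -> E y x) -> (forall x y z, E x y -> E y z -> E x z) ->
  transversal E X A -> transversal E X B -> (A #= B)%card.
Proof.
move=> Esym Etrans [AX Aex Auniq] [BX Bex Buniq].
have /choice[g gP] x : exists b, X x -> B b /\ E x b.
  case: (pselect (X x)) => [/Bex[b Bb Exb] | nXx]; first by exists b.
  (* A dummy value outside [X]. *)
  by exists x.
apply: (@set_bij_card_eq _ _ _ _ g); split.
- by move=> a /AX/gP[].
- move=> a b /set_mem Aa /set_mem Ab gab; apply: Auniq => //.
  have [_ Ea] := gP a (AX a Aa); have [_ Eb] := gP b (AX b Ab).
  by apply: Etrans Ea _; rewrite gab; apply: Esym.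
- move=> b Bb; have [a Aa Eba] := Aex b (BX b Bb); exists a => //.
  have [Bga Ega] := gP a (AX a Aa).
  by apply: Buniq => //; apply: Esym; apply: Etrans Eba Ega.
Qed.

Lemma mulrz_mulrn (R : realType) (x : R) (e : int) (k : nat) :
  x *~ (e *+ k) = x *+ k *~ e.
Proof. by rewrite -mulrzr rmorphMn /= -[RHS]mulrzr mulrnAr mulrnAl. Qed.

Section Transversals.
Context (R : realType) (G : zmodClosed R) (n : nat) (c m : R).
Context (hcG : c \in G) (hmG : m \in G) (hc : 0 < c) (hm : 0 <= m).
Local Notation N := (m *+ n.+1 + c).
Let N_gt0 : 0 < N := period_gt0 R n.+1 c m hc hm.

Lemma skeletal_transversal (k : nat) : (k < n.+1)%N ->
  transversal (chip_equiv c m) [set f : 'I_n.+1 -> R | forall i, f i \in G]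
    (SKF G n.+1 c m k).
Proof.
move=> lt_kn; split.
- by move=> f [].
- move=> f fG; have [g [a g_eq] skg] := skeletal_exists _ _ c m hc hm _ lt_kn f.
  by exists g; [split=> //; rewrite g_eq; apply: shift_in | exists a].
- by move=> f g [_ skf] [_ skg] Efg; apply: skeletal_unique skf skg.
Qed.

Definition slab : set ('I_n.+1 -> R) :=
  [set f | [/\ forall i, f i \in G, 0 <= f ord0 < c &
               forall i, 0 <= f i - f ord0 < N]].

Lemma slab_transversal :
  transversal (chip_equiv c m) [set f : 'I_n.+1 -> R | forall i, f i \in G] slab.
Proof.
split.
- by move=> f [].
- move=> f fG.
  (* [b] reduces the differences to [f ord0] modulo [N]; a further constant [e] keeps them and
     translates all values by [- e c], as [N - m n.+1 = c]. *)
  pose b i := Num.floor ((f i - f ord0) / N).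
  pose e := Num.floor (shift c m b f ord0 / c).
  exists (shift c m (fun i => b i + e) f); last by exists (fun i => b i + e).
  split; first exact: shift_in.
  + have -> : shift c m (fun i => b i + e) f ord0 = shift c m b f ord0 - e%:~R * c.
      rewrite -shift_comp {1}/shift sumr_const card_ord mulrz_mulrn.
      by move: (shift c m b f ord0) => x; rewrite -(mulrzr N e); ring.
    have /andP[] := floor_itv (shift c m b f ord0 / c); rewrite -/e.
    rewrite ler_pdivlMr // ltr_pdivrMr // intrD => H1 H2.
    by apply/andP; split; lra.
  + move=> i; have /andP[] := floor_itv ((f i - f ord0) / N); rewrite -/(b i).
    rewrite ler_pdivlMr // ltr_pdivrMr // intrD => H1 H2.
    have b0 : b ord0 = 0 by rewrite /b subrr mul0r floor0.
    have -> : shift c m (fun i => b i + e) f i - shift c m (fun i => b i + e) f ord0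
        = f i - f ord0 - (b i)%:~R * N.
      by rewrite /shift b0 add0r mulrzDr -(mulrzr N (b i)); ring.
    by apply/andP; split; lra.
- move=> f g [_ f0 fi] [_ g0 gi] [a g_eq]; apply/esym; rewrite g_eq; apply: shift0.
  (* The differences to vertex [ord0] change by multiples of [N] within [[0, N)], so [a] is
     constant; then the value there moves by a multiple of [c] within [[0, c)]. *)
  have a_const i : a i = a ord0.
    apply/eqP; rewrite -subr_eq0; apply/eqP; apply: (small_mulrz_eq0 R N).
    have := fi i; have := gi i; rewrite g_eq /shift mulrzBr; lra.
  have a0 : a ord0 = 0.
    apply: (small_mulrz_eq0 R c); move: g0; rewrite g_eq /shift.
    rewrite (eq_bigr _ (fun i _ => a_const i)) sumr_const card_ord.
    have -> : m *~ (a ord0 *+ n.+1) = m *+ n.+1 *~ a ord0.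
      by rewrite mulrz_mulrn.
    by rewrite mulrzDl; lra.
  by move=> i; rewrite a_const.
Qed.

End Transversals.
Arguments slab {R} G n c m.

(** * Counting *)

Lemma SKF_card_slab (R : realType) (G : zmodClosed R) (n : nat) (c m : R)
    (hcG : c \in G) (hmG : m \in G) (hc : 0 < c) (hm : 0 <= m) (k : nat) :
  (k < n.+1)%N -> (SKF G n.+1 c m k #= slab G n c m)%card.
Proof.
move=> lt_kn.
apply: (@transversal_card_eq _ (@chip_equiv R n.+1 c m) [set f | forall i, f i \in G]).
- by move=> f g; apply: chip_equiv_sym.
- by move=> f g h; apply: chip_equiv_trans.
- exact: skeletal_transversal.
- exact: slab_transversal.
Qed.

(** An integer point of the slab is coded by its value at [ord0], in ['I_c], and its [n] differences
    to that value, in ['I_N]. *)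
Lemma slab_int_card (R : realType) (G : zmodClosed R) (n c m : nat) :
    G =i (Num.int : {pred R}) ->
  (slab G n c%:R m%:R #= `I_(c * (m * n.+1 + c) ^ n))%card.
Proof.
move=> G_int; set N := (m * n.+1 + c)%N.
have N_eq : m%:R *+ n.+1 + c%:R = N%:R :> R by rewrite /N natrD natrM mulr_natr.
have -> : (c * N ^ n)%N = #|{: 'I_c * {ffun 'I_n -> 'I_N}}|.
  by rewrite card_prod card_ffun !card_ord.
rewrite card_eq_sym; apply: card_eq_trans card_II _.
apply: (@card_eq_trans _ _ _ _ [set: 'I_c * {ffun 'I_n -> 'I_N}]).
  by apply: (@set_bij_card_eq _ _ _ _ enum_val); split.
pose F (p : 'I_c * {ffun 'I_n -> 'I_N}) (i : 'I_n.+1) : R :=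
  if unlift ord0 i is Some j then (p.1 + p.2 j)%N%:R else (nat_of_ord p.1)%:R.
apply: (@set_bij_card_eq _ _ _ _ F); split.
- move=> [u v] _; rewrite /F; split.
  + by move=> i; rewrite G_int; case: unlift => *; apply: natr_int.
  + by rewrite unlift_none /= ler0n ltr_nat ltn_ord.
  + move=> i; rewrite unlift_none N_eq; case: unliftP => [j|] _ /=.
      by rewrite natrD addrC addKr ler0n ltr_nat ltn_ord.
    (* The existence of [u : 'I_c] forces [c > 0], hence [N > 0]. *)
    by have := ltn_ord u; rewrite subrr lexx ltr0n; lia.
- move=> [u v] [u' v'] _ _ F_eq.
  have u_eq : u = u'.
    apply: val_inj; apply: (mulrIn (oner_neq0 R)); move: (congr1 (@^~ ord0) F_eq).
    by rewrite /F unlift_none.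
  congr pair => //; apply/ffunP => j; apply: val_inj.
  apply: (mulrIn (oner_neq0 R)); move: (congr1 (@^~ (lift ord0 j)) F_eq).
  by rewrite /F liftK /= u_eq !natrD => /addrI.
- move=> f [fG /andP[f0_ge0 f0_lt] fi]; rewrite N_eq in fi.
  have /natrP[u u_eq] : f ord0 \is a Num.nat by rewrite natrEint -G_int fG.
  have lt_uc : (u < c)%N by rewrite -(ltr_nat R) -u_eq.
  have /choice[v v_eq] (j : 'I_n) :
      exists w : 'I_N, f (lift ord0 j) = (u + w)%N%:R.
    have /andP[fj_ge0 fj_lt] := fi (lift ord0 j).
    have /natrP[w w_eq] : f (lift ord0 j) - f ord0 \is a Num.nat.
      by rewrite natrEint fj_ge0 -G_int rpredB.
    have lt_wN : (w < N)%N by rewrite -(ltr_nat R) -w_eq.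
    by exists (Ordinal lt_wN); rewrite natrD -u_eq /= -w_eq addrC subrK.
  exists (Ordinal lt_uc, [ffun j => v j]) => //.
  apply/funext => i; rewrite /F; case: unliftP => [j|] -> //=.
  by rewrite ffunE v_eq.
Qed.

Theorem theorem4p2 (R : realType) (G : zmodClosed R) (n : nat) (c m : R)
    (hn : (0 < n)%N) (hcG : c \in G) (hmG : m \in G)
    (hc : 0 < c) (hm : 0 <= m) :
  [/\ forall k : nat, (k < n)%N -> SKC G n c m k = SKF G n c m k,
      forall k k' : nat, (k < n)%N -> (k' < n)%N ->
        (SKC G n c m k #= SKC G n c m k')%card
    & G =i (Num.int : {pred R}) -> forall k : nat, (k < n)%N ->
        finite_set (SKC G n c m k) /\
        (#|` fset_set (SKC G n c m k)|)%:R = c * (m *+ n + c) ^+ (n - 1) ].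
Proof.
have SKC_eq k : (k < n)%N -> SKC G n c m k = SKF G n c m k.
  move=> lt_kn; apply/seteqP; split=> f [fG skf]; split=> //.
    exact/skeletal_configE.
  exact/skeletal_configE.
split=> // [k k' lt_kn lt_k'n | G_int k lt_kn].
  rewrite !SKC_eq //; case: n hn lt_kn lt_k'n {SKC_eq} => // n' _ lt_kn lt_k'n.
  apply: card_eq_trans (SKF_card_slab _ _ _ _ _ hcG hmG hc hm _ lt_kn) _.
  by rewrite card_eq_sym; apply: SKF_card_slab.
rewrite SKC_eq //; case: n hn lt_kn {SKC_eq} => // n' _ lt_kn.
have [c' c_eq] : exists c' : nat, c = c'%:R.
  by apply/natrP; rewrite natrEint -G_int hcG ltW.
have [m' m_eq] : exists m' : nat, m = m'%:R.
  by apply/natrP; rewrite natrEint -G_int hmG hm.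
have card_eq : (SKF G n'.+1 c m k #= `I_(c' * (m' * n'.+1 + c') ^ n'))%card.
  apply: card_eq_trans (SKF_card_slab _ _ _ _ _ hcG hmG hc hm _ lt_kn) _.
  by rewrite c_eq m_eq; apply: slab_int_card.
split; first by apply/finite_setP; eexists; exact: card_eq.
rewrite (card_fset_set card_eq) subn1 /= c_eq m_eq.
by rewrite natrM natrX natrD natrM mulr_natr.
Qed.
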